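(* The generalized Camassa-Holm equation $$u_t - u_{xxt} = u^2 u_{xxx} - u^2u_{xx}-3uu_x^2-2u^2u_x+4u u_x u_{xx}+u_x^3$$ admits a quadratic pseudo-potential $\gamma$ determined by the equations $$2\gamma_x =2\gamma+\gamma^2\eta(u-u_{xx}+1),\qquad 2\gamma_t=\gamma^2\eta(u^2u_{xx}-2u^2u_x+uu_x^2),$$ in which $\eta\neq 0$ is a (real) parameter. Moreover, the equation possesses the parameter-dependent conservation law $$[\gamma(u-u_{xx}+1)]_t=[\gamma(u^2u_{xx}-2u^2u_x+uu_x^2)]_x ,$$ which holds whenever $u(x,t)$ is a solution of the generalized Camassa-Holm equation and $\gamma$ solves the system $2\gamma_x =2\gamma+\gamma^2\eta(u-u_{xx}+1)$, $2\gamma_t=\gamma^2\eta(u^2u_{xx}-2u^2u_x+uu_x^2)$.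
   Context: For a scalar partial differential equation $\Xi=0$ for $u(x,t)$, a function $\Gamma$ determined by equations $\Gamma_x=f$, $\Gamma_t=g$ (with $f,g$ depending on $\Gamma$, $u$ and derivatives of $u$) is called a pseudo-potential for $\Xi=0$ if $f_t=g_x$ holds whenever $\Gamma_x=f$, $\Gamma_t=g$ and $u(x,t)$ is a solution of $\Xi=0$ (i.e. the system for $\Gamma$ is completely integrable on solutions of $\Xi=0$). It is quadratic if $f$ and $g$ are polynomials of degree at most $2$ in $\Gamma$. *)

(* Defs.v *)
From Stdlib Require Import Reals.
From Coquelicot Require Import Coquelicot.
Open Scope R_scope.

(* A jet [j] lists the value of a function of (x,t) and of its partial
   derivatives at a point: [j a b] stands for the derivative taken [a] times
   in x and [b] times in t.  In [partial_derive] the t-derivatives are innermost;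
   for the functions considered below ([is_solution]) the order is immaterial
   at orders up to [k]. *)
Definition jet : Type := nat -> nat -> R.

Definition jet_of (u : R -> R -> R) (x t : R) : jet :=
  fun a b => partial_derive a b u x t.

Definition order_lt (k : nat) (F : jet -> R) : Prop :=
  forall j j' : jet,
    (forall a b : nat, (a + b < k)%nat -> j a b = j' a b) -> F j = F j'.

(* Classical C^k solutions of Xi = 0 on W; [ex_diff_n u k x t] says that all
   the partial derivatives of [u] of order at most [k], taken in any sequence
   of variables, exist and are continuous. *)
Definition is_solution (k : nat) (Xi : jet -> R) (W : R * R -> Prop)
    (u : R -> R -> R) : Prop :=
  forall x t : R, W (x, t) -> ex_diff_n u k x t /\ Xi (jet_of u x t) = 0.

(* The equations Gamma_x = f, Gamma_t = g at the point (x,t). *)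
Definition system_at (f g : R -> jet -> R) (u Gamma : R -> R -> R)
    (x t : R) : Prop :=
  is_derive (fun s => Gamma s t) x (f (Gamma x t) (jet_of u x t)) /\
  is_derive (fun s => Gamma x s) t (g (Gamma x t) (jet_of u x t)).

(* The derivatives A_t and B_x at (x,t) exist and are equal. *)
Definition cross_derivatives_agree (A B : R -> R -> R) (x t : R) : Prop :=
  exists d : R,
    is_derive (fun s => A x s) t d /\ is_derive (fun s => B s t) x d.

(* Compatibility f_t = g_x, asked at each point where Gamma_x = f and
   Gamma_t = g hold, for every Gamma satisfying them at that point.  Since
   Gamma may take any value there, this is, for differentiable [f] and [g],
   Frobenius' complete integrability condition for the system on W x R:
     f_t|u + f_Gamma g = g_x|u + g_Gamma f.
   Asking it only of functions Gamma that solve the system on all of W would be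
   void, by the symmetry of second derivatives.
   [f] and [g] involve derivatives of u of order less than the class [k] of
   the solutions, so that f_t and g_x are expressed by continuous derivatives
   of u. *)
Definition pseudo_potential (k : nat) (Xi : jet -> R) (f g : R -> jet -> R)
    : Prop :=
  (forall G : R, order_lt k (f G) /\ order_lt k (g G)) /\
  forall (W : R * R -> Prop) (u : R -> R -> R),
    open W -> is_solution k Xi W u ->
    forall (Gamma : R -> R -> R) (x t : R),
      W (x, t) -> system_at f g u Gamma x t ->
      cross_derivatives_agree
        (fun x' t' => f (Gamma x' t') (jet_of u x' t'))
        (fun x' t' => g (Gamma x' t') (jet_of u x' t')) x t.

Definition quadratic (f : R -> jet -> R) : Prop :=
  exists c0 c1 c2 : jet -> R,
    forall (G : R) (j : jet), f G j = c0 j + c1 j * G + c2 j * G ^ 2.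

Definition quadratic_pseudo_potential (k : nat) (Xi : jet -> R)
    (f g : R -> jet -> R) : Prop :=
  pseudo_potential k Xi f g /\ quadratic f /\ quadratic g.

(* The generalized Camassa-Holm equation, left-hand side minus right-hand side. *)
Definition gCH (j : jet) : R :=
  let u := j 0%nat 0%nat in
  let ux := j 1%nat 0%nat in
  let uxx := j 2%nat 0%nat in
  let uxxx := j 3%nat 0%nat in
  let ut := j 0%nat 1%nat in
  let uxxt := j 2%nat 1%nat in
  (ut - uxxt)
  - (u ^ 2 * uxxx - u ^ 2 * uxx - 3 * u * ux ^ 2 - 2 * u ^ 2 * ux
     + 4 * u * ux * uxx + ux ^ 3).

Definition gCH_m (j : jet) : R :=
  let u := j 0%nat 0%nat in
  let uxx := j 2%nat 0%nat in
  u - uxx + 1.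

Definition gCH_q (j : jet) : R :=
  let u := j 0%nat 0%nat in
  let ux := j 1%nat 0%nat in
  let uxx := j 2%nat 0%nat in
  u ^ 2 * uxx - 2 * u ^ 2 * ux + u * ux ^ 2.

Definition gCH_f (eta G : R) (j : jet) : R :=
  (2 * G + G ^ 2 * eta * gCH_m j) / 2.

Definition gCH_g (eta G : R) (j : jet) : R :=
  (G ^ 2 * eta * gCH_q j) / 2.

(* Main.v *)
(* Write m = u - u_xx + 1 and q = u^2 u_xx - 2 u^2 u_x + u u_x^2. The generalized
   Camassa-Holm equation is exactly m_t = q + q_x. Substituting the system for
   gamma, both f_t = g_x and the conservation law (gamma m)_t = (gamma q)_x
   reduce to this identity. *)
Require Import Defs.
From Stdlib Require Import Reals Lia Lra.
From Coquelicot Require Import Coquelicot.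
Open Scope R_scope.

(** In [partial_derive] the x-derivatives are outermost, so one more of them gives the next jet
    entry by conversion; regularity at the point suffices. *)
Lemma is_derive_jet_x (k : nat) (u : R -> R -> R) (x t : R) (a b : nat) :
  (a + b < k)%nat -> ex_diff_n u k x t ->
  is_derive (fun s => jet_of u s t a b) x (jet_of u x t (S a) b).
Proof.
  intros hab hu.
  exact (Derive_correct _ _ (ex_diff_n_ex_deriv_inf_1 k a b hab u x t hu)).
Qed.

(* [jet_of] takes the t-derivatives first, so this exchanges derivatives and
   needs regularity in a neighbourhood. *)
Lemma is_derive_jet_t (k : nat) (u : R -> R -> R) (x t : R) (a b : nat) :
  (a + b < k)%nat -> locally_2d (ex_diff_n u k) x t ->
  is_derive (fun s => jet_of u x s a b) t (jet_of u x t a (S b)).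
Proof.
  intros hab hu.
  unfold jet_of; rewrite <- Derive_partial_derive.
  - apply Derive_correct, (ex_diff_n_ex_deriv_inf_2 k a b hab).
    exact (locally_2d_singleton _ _ _ hu).
  - refine (locally_2d_impl _ _ _ _ _ hu); apply locally_2d_forall; intros x' t'.
    apply ex_diff_n_m; lia.
Qed.

(** Openness of [W] turns regularity at each point into the neighbourhood form that
    [is_derive_jet_t] requires. *)
Lemma solution_locally_regular (k : nat) (Xi : jet -> R) (W : R * R -> Prop)
    (u : R -> R -> R) (x t : R) :
  open W -> is_solution k Xi W u -> W (x, t) ->
  locally_2d (ex_diff_n u k) x t.
Proof.
  intros hW hu hxt; apply locally_2d_locally.
  refine (filter_imp _ _ _ (hW _ hxt)); intros [x' t'] h.
  exact (proj1 (hu _ _ h)).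
Qed.

(** Here [v], [v1], [v2] stand for u, u_x, u_xx. In this and the next lemmas arbitrary functions
    replace jet entries, so that [auto_derive] treats them as atoms. *)
Lemma is_derive_q_poly (v v1 v2 : R -> R) (x d d1 d2 : R) :
  is_derive v x d -> is_derive v1 x d1 -> is_derive v2 x d2 ->
  is_derive (fun s => v s ^ 2 * v2 s - 2 * v s ^ 2 * v1 s + v s * v1 s ^ 2) x
    (2 * v x * d * v2 x + v x ^ 2 * d2
     - 4 * v x * d * v1 x - 2 * v x ^ 2 * d1
     + d * v1 x ^ 2 + 2 * v x * v1 x * d1).
Proof.
  intros; auto_derive; [repeat split; eexists; eassumption |].
  repeat (erewrite is_derive_unique by eassumption); field.
Qed.

Lemma is_derive_m_poly (v v2 : R -> R) (x d d2 : R) :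
  is_derive v x d -> is_derive v2 x d2 ->
  is_derive (fun s => v s - v2 s + 1) x (d - d2).
Proof.
  intros; auto_derive; [repeat split; eexists; eassumption |].
  repeat (erewrite is_derive_unique by eassumption); field.
Qed.

Lemma is_derive_f_poly (eta : R) (G m : R -> R) (x dG dm : R) :
  is_derive G x dG -> is_derive m x dm ->
  is_derive (fun s => (2 * G s + G s ^ 2 * eta * m s) / 2) x
    (dG + G x * dG * eta * m x + G x ^ 2 * eta * dm / 2).
Proof.
  intros; auto_derive; [repeat split; eexists; eassumption |].
  repeat (erewrite is_derive_unique by eassumption); field.
Qed.

Lemma is_derive_g_poly (eta : R) (G q : R -> R) (x dG dq : R) :
  is_derive G x dG -> is_derive q x dq ->
  is_derive (fun s => (G s ^ 2 * eta * q s) / 2) x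
    (G x * dG * eta * q x + G x ^ 2 * eta * dq / 2).
Proof.
  intros; auto_derive; [repeat split; eexists; eassumption |].
  repeat (erewrite is_derive_unique by eassumption); field.
Qed.

Lemma is_derive_Rmult (G m : R -> R) (x dG dm : R) :
  is_derive G x dG -> is_derive m x dm ->
  is_derive (fun s => G s * m s) x (dG * m x + G x * dm).
Proof.
  intros; auto_derive; [repeat split; eexists; eassumption |].
  repeat (erewrite is_derive_unique by eassumption); field.
Qed.

(** The differential equation enters here, as m_t = q + q_x. Class 3 covers u_xxx in q_x and u_xxt
    in m_t. *)
Lemma gCH_m_t_q_x (W : R * R -> Prop) (u : R -> R -> R) (x t : R) :
  open W -> is_solution 3 gCH W u -> W (x, t) ->
  exists qx : R,
    is_derive (fun s => gCH_q (jet_of u s t)) x qx /\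
    is_derive (fun s => gCH_m (jet_of u x s)) t (gCH_q (jet_of u x t) + qx).
Proof.
  intros hW hu hxt.
  pose proof (solution_locally_regular _ _ _ _ _ _ hW hu hxt) as hloc.
  destruct (hu _ _ hxt) as [hreg heq].
  assert (d0 := is_derive_jet_x 3 u x t 0 0 ltac:(lia) hreg).
  assert (d1 := is_derive_jet_x 3 u x t 1 0 ltac:(lia) hreg).
  assert (d2 := is_derive_jet_x 3 u x t 2 0 ltac:(lia) hreg).
  assert (e0 := is_derive_jet_t 3 u x t 0 0 ltac:(lia) hloc).
  assert (e2 := is_derive_jet_t 3 u x t 2 0 ltac:(lia) hloc).
  unfold gCH in heq; unfold gCH_q, gCH_m; cbv zeta in *.
  eexists; split; [exact (is_derive_q_poly _ _ _ _ _ _ _ d0 d1 d2) |].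
  (* After expansion, u_t - u_xxt = q + q_x is [heq] rearranged, linear once monomials count as
     atoms. *)
  evar_last; [exact (is_derive_m_poly _ _ _ _ _ e0 e2) | cbv beta; lra].
Qed.

Lemma gCH_pseudo_potential (eta : R) :
  pseudo_potential 3 gCH (gCH_f eta) (gCH_g eta).
Proof.
  split.
  - intros G; split; intros j j' h; unfold gCH_f, gCH_g, gCH_m, gCH_q;
      rewrite ?(h 0%nat 0%nat), ?(h 1%nat 0%nat), ?(h 2%nat 0%nat) by lia;
      reflexivity.
  - intros W u hW hu Gamma x t hxt [hx ht].
    destruct (gCH_m_t_q_x W u x t hW hu hxt) as [qx [hq hm]].
    unfold gCH_f, gCH_g in *.
    eexists; split; [exact (is_derive_f_poly eta _ _ _ _ _ ht hm) |].
    (* Both sides equal G^2 eta q + G^3 eta^2 m q / 2 + G^2 eta q_x / 2. In f_t, the first term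
       comes half from Gamma_t and half from m_t. *)
    evar_last; [exact (is_derive_g_poly eta _ _ _ _ _ hx hq) | cbv beta; field].
Qed.

Lemma gCH_conservation_law (eta : R) (W : R * R -> Prop)
    (u gamma : R -> R -> R) (x t : R) :
  open W -> is_solution 3 gCH W u -> W (x, t) ->
  system_at (gCH_f eta) (gCH_g eta) u gamma x t ->
  cross_derivatives_agree
    (fun x' t' => gamma x' t' * gCH_m (jet_of u x' t'))
    (fun x' t' => gamma x' t' * gCH_q (jet_of u x' t')) x t.
Proof.
  intros hW hu hxt [hx ht].
  destruct (gCH_m_t_q_x W u x t hW hu hxt) as [qx [hq hm]].
  unfold gCH_f, gCH_g in *.
  eexists; split; [exact (is_derive_Rmult _ _ _ _ _ ht hm) |].
  (* Both sides equal gamma q + gamma q_x + gamma^2 eta m q / 2: the q in m_t matches the linear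
     term of gamma_x. *)
  evar_last; [exact (is_derive_Rmult _ _ _ _ _ hx hq) | cbv beta; field].
Qed.

Theorem theorem2 (eta : R) (heta : eta <> 0) :
  quadratic_pseudo_potential 3 gCH (gCH_f eta) (gCH_g eta) /\
  (forall (W : R * R -> Prop) (u gamma : R -> R -> R),
     open W ->
     is_solution 3 gCH W u ->
     (forall x t : R, W (x, t) ->
        system_at (gCH_f eta) (gCH_g eta) u gamma x t) ->
     forall x t : R, W (x, t) ->
       cross_derivatives_agree
         (fun x' t' => gamma x' t' * gCH_m (jet_of u x' t'))
         (fun x' t' => gamma x' t' * gCH_q (jet_of u x' t')) x t).
Proof.
  split.
  - split; [apply gCH_pseudo_potential | split].
    + exists (fun _ => 0), (fun _ => 1), (fun j => eta * gCH_m j / 2).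
      intros G j; unfold gCH_f; field.
    + exists (fun _ => 0), (fun _ => 0), (fun j => eta * gCH_q j / 2).
      intros G j; unfold gCH_g; field.
  - intros W u gamma hW hu hsys x t hxt.
    exact (gCH_conservation_law eta W u gamma x t hW hu hxt (hsys x t hxt)).
Qed.
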